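(* Let $n,m\ge 1$ and let $\mathbf{u}:\mathbb{R}^m\times\mathbb{R}_{\ge 0}\to\mathbb{R}^n$ be a solution of the quadratic evolution equation $$\frac{\partial \mathbf{u}(\mathbf{x})}{\partial t}=F_0(\mathbf{x})+F_1(\mathbf{x})\mathbf{u}(\mathbf{x})+F_2(\mathbf{x};\mathbf{w})\left[\mathbf{u}(\mathbf{x})\otimes\mathbf{u}(\mathbf{w})\right],\qquad \mathbf{u}(\mathbf{x},t=0)=\mathbf{u}_0(\mathbf{x}),$$ where the time dependence of $\mathbf{u}$ is suppressed and $F_0,F_1,F_2$ are time independent and as described in the context. For each integer $i\ge 1$ let $$\mathbf{y}_i:=\mathbf{u}(\mathbf{x}_1)\otimes\mathbf{u}(\mathbf{x}_2)\otimes\cdots\otimes\mathbf{u}(\mathbf{x}_i),$$ a function of $\mathbf{x}_1,\dots,\mathbf{x}_i\in\mathbb{R}^m$ and $t$ with values in $\mathbb{R}^{n^i}$, let $\mathbf{y}_0:=1$, and write $\boldsymbol{\mathcal{X}}_i:=[\mathbf{x}_1^{\mathsf T},\dots,\mathbf{x}_i^{\mathsf T}]^{\mathsf T}\in\mathbb{R}^{i\cdot m}$. Then for every $i\ge 1$ the time evolution of $\mathbf{y}_i$ is given by the tridiagonal linear system $$\frac{\partial \mathbf{y}_i}{\partial t}=A_{i-1}^i(\boldsymbol{\mathcal{X}}_i)\,\mathbf{y}_{i-1}+A_i^i(\boldsymbol{\mathcal{X}}_i)\,\mathbf{y}_i+A_{i+1}^i(\boldsymbol{\mathcal{X}}_i;\mathbf{x}_{i+1})\,\mathbf{y}_{i+1},$$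 with the linear operators $$A_{i-1}^i(\boldsymbol{\mathcal{X}}_i):=\sum_{\nu=1}^{i}\Big(\mathbb{I}_n\otimes\cdots\otimes\underbrace{F_0(\mathbf{x}_\nu)}_{\nu\text{-th position}}\otimes\cdots\otimes\mathbb{I}_n\Big)\overrightarrow{\Big|}_{\mathbf{x}_j=\mathbf{x}_{j+1}\ \forall j\ge\nu},$$ $$A_i^i(\boldsymbol{\mathcal{X}}_i):=\sum_{\nu=1}^{i}\Big(\mathbb{I}_n\otimes\cdots\otimes\underbrace{F_1(\mathbf{x}_\nu)}_{\nu\text{-th position}}\otimes\cdots\otimes\mathbb{I}_n\Big),$$ $$A_{i+1}^i(\boldsymbol{\mathcal{X}}_i;\mathbf{x}_{i+1}):=\sum_{\nu=1}^{i}\Big(\mathbb{I}_n\otimes\cdots\otimes\underbrace{F_2(\mathbf{x}_\nu;\mathbf{w}_i)}_{\nu\text{-th position}}\otimes\cdots\otimes\mathbb{I}_n\Big)\overrightarrow{\Big|}_{\mathbf{x}_j=\mathbf{x}_{j-1}\ \forall j\ge\nu+2}\ \overrightarrow{\Big|}_{\mathbf{x}_{\nu+1}=\mathbf{w}_i},$$ where each Kronecker product has $i$ factors.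
   Context: Coefficients of the equation. $F_0(\mathbf{x})$ is an $n\times 1$ vector of real-valued functions of $\mathbf{x}\in\mathbb{R}^m$ (no differential operators). $F_1(\mathbf{x})$ is an $n\times n$ matrix whose entries are linear partial differential operators in $\mathbf{x}$ (coefficients may depend on $\mathbf{x}$). $F_2(\mathbf{x};\mathbf{w})$ is an $n\times n^2$ matrix whose entries are linear operators, acting with respect to the variables $\mathbf{x},\mathbf{w}\in\mathbb{R}^m$, each sending a scalar function of $(\mathbf{x},\mathbf{w})$ to a scalar function of $\mathbf{x}$ alone. They are partial differential operators in $\mathbf{x},\mathbf{w}$ combined with a contraction eliminating $\mathbf{w}$, for example the substitution $\mathbf{w}=\mathbf{x}$ or an integration over $\mathbf{w}$. The semicolon separates the free variable $\mathbf{x}$ from the eliminated (dummy) variable $\mathbf{w}$. All coefficients are independent of $t$. Regularity convention. $\mathbf{u}$ is differentiable in $t$, and for each $t$ its components lie in a linear space of functions on which the entries of $F_1$ are defined, and the products $(\mathbf{x},\mathbf{w})\mapsto u_b(\mathbf{x},t)u_c(\mathbf{w},t)$ lie in a linear space of functions on which the entries of $F_2$ are defined, so that all expressions make sense. Kronecker products. $\otimes$ is the Kronecker product (components of $\mathbf{y}_i$ are $u_{a_1}(\mathbf{x}_1)\cdots u_{a_i}(\mathbf{x}_i)$, with $(a_1,\dots,a_i)$ in lexicographic order), and $\mathbb{I}_n$ is the $n\times n$ identity matrix. A Kronecker product of copies of $\mathbb{I}_n$ with one operator-valued matrix $F_j$ in position $\nu$ is the corresponding $n^i\times n^{i+j-1}$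 matrix of operators. It acts by matrix multiplication, its entries acting only in the indicated variables ($\mathbf{x}_\nu$ for $F_0,F_1$, with $F_0$ acting by multiplication; $\mathbf{x}_\nu$ and $\mathbf{w}_i$ for $F_2(\mathbf{x}_\nu;\mathbf{w}_i)$), with all other variables treated as fixed parameters. Here $\mathbf{w}_i\in\mathbb{R}^m$ is a dummy variable eliminated by $F_2(\cdot;\mathbf{w}_i)$. Variable change operator. $\overrightarrow{|}_{\mathbf{a}=\mathbf{b}}$ is the linear operator acting to its right that replaces the variable $\mathbf{a}$ by $\mathbf{b}$: $\overrightarrow{|}_{\mathbf{a}=\mathbf{b}}\,\mathbf{f}(\mathbf{a}):=\mathbf{f}(\mathbf{b})$. With a ''$\forall j$'' condition, all the indicated replacements are made simultaneously for those variables $\mathbf{x}_j$ present in the function acted upon. In a product of two such operators the rightmost acts first. Thus in $A_{i-1}^i$ the function $\mathbf{y}_{i-1}$ becomes $\mathbf{u}(\mathbf{x}_1)\otimes\cdots\otimes\mathbf{u}(\mathbf{x}_{\nu-1})\otimes\mathbf{u}(\mathbf{x}_{\nu+1})\otimes\cdots\otimes\mathbf{u}(\mathbf{x}_i)$ before the matrix is applied. In $A_{i+1}^i$ the function $\mathbf{y}_{i+1}$ becomes $\mathbf{u}(\mathbf{x}_1)\otimes\cdots\otimes\mathbf{u}(\mathbf{x}_\nu)\otimes\mathbf{u}(\mathbf{w}_i)\otimes\mathbf{u}(\mathbf{x}_{\nu+1})\otimes\cdots\otimes\mathbf{u}(\mathbf{x}_i)$. Convention for $i=1$. $\mathbf{y}_0=1$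 is a constant and not a dynamical variable, so $A_0^1\mathbf{y}_0=F_0(\mathbf{x}_1)$. *)

(* Defs.v *)
From mathcomp Require Import all_boot all_order all_algebra.
From mathcomp Require Import all_classical all_reals all_analysis.
From mathcomp Require Export mxtens.

Set Implicit Arguments.
Unset Strict Implicit.
Unset Printing Implicit Defensive.

Import Order.TTheory GRing.Theory Num.Theory.
Import numFieldNormedType.Exports.
Local Open Scope classical_set_scope.
Local Open Scope ring_scope.

(* Points of R^m are rows 'rV[R]_m, and [x_1; ...; x_i] in R^(i*m) is the
   i x m matrix whose k-th row is x_(k+1): indices are 0-based throughout.  An
   operator between scalar functions is a total Coq function; hypotheses on it
   only concern the linear space V of functions on which it is "defined", its
   values elsewhere being unspecified. *)
Definition op (R : Type) (S S' : Type) : Type := (S -> R) -> S' -> R.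

Definition linear_space (R : realType) (S : Type) (V : set (S -> R)) : Prop :=
  V (fun=> 0) /\
  forall (c : R) (f g : S -> R), V f -> V g -> V (fun x => c * f x + g x).

(* Differentiation in (x, w) combined with a contraction eliminating w, such as
   w := x or an integral over w, is an operator of this kind from functions of
   (x, w) to functions of x; the contraction being arbitrary, nothing more
   specific is imposed on it. *)
Definition linear_on (R : realType) (S S' : Type)
    (V : set (S -> R)) (L : op R S S') : Prop :=
  forall (c : R) (f g : S -> R), V f -> V g ->
    forall x, L (fun s => c * f s + g s) x = c * L f x + L g x.

Section PartialDifferentialOperators.
Variables (R : realType) (m : nat).

(* The word [:: k_1; ...; k_r] denotes d_(k_1) ... d_(k_r), rightmost first. *)
Fixpoint pderive (s : seq 'I_m) (f : 'rV[R]_m -> R) : 'rV[R]_m -> R :=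
  if s is k :: s' then fun x => 'D_(delta_mx 0 k) (pderive s' f) x else f.

(* 'D_v is total, so existence of the derivatives is a separate condition. *)
Fixpoint pderivable (s : seq 'I_m) (f : 'rV[R]_m -> R) : Prop :=
  if s is k :: s' then
    pderivable s' f /\ forall x, derivable (pderive s' f) x (delta_mx 0 k)
  else True.

Definition pdo_on (V : set ('rV[R]_m -> R))
    (L : op R 'rV[R]_m 'rV[R]_m) : Prop :=
  exists (r : nat) (c : 'I_r -> 'rV[R]_m -> R) (d : 'I_r -> seq 'I_m),
  forall f, V f ->
    (forall k, pderivable (d k) f) /\
    forall x, L f x = \sum_(k < r) c k x * pderive (d k) f x.

End PartialDifferentialOperators.

(* Derivative relative to the time domain [0, +oo[; one-sided at t = 0. *)
Definition time_derivative (R : realType) (p : nat)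
    (f : R -> 'cV[R]_p) (t : R) (l : 'cV[R]_p) : Prop :=
  forall a : 'I_p,
    (fun s : R => (s - t)^-1 * (f s a 0 - f t a 0))
      @ within [set s : R | 0 <= s] t^' --> l a 0.

(* Matrices of operators act by matrix multiplication. *)
Definition opmx_app (R : realType) (S S' : Type) (p q : nat)
    (M : 'M[op R S S']_(p, q)) (g : S -> 'cV[R]_q) : S' -> 'cV[R]_p :=
  fun s => \col_a \sum_b M a b (fun s0 => g s0 b 0) s.

(* [*t] is the binary Kronecker product, with lexicographic index (i, j) |->
   i * n + j; the casts only identify p * p ^ i' with p ^ i'.+1. *)
Fixpoint kron (R : realType) (p q i : nat) :
    ('I_i -> 'M[R]_(p, q)) -> 'M[R]_(p ^ i, q ^ i) :=
  match i with
  | 0 => fun=> 1%:M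
  | i'.+1 => fun A =>
      castmx (esym (expnS p i'), esym (expnS q i'))
        (A ord0 *t kron (fun k : 'I_i' => A (lift ord0 k)))
  end.

(* A (x) L (x) B, for real matrices A, B and an operator matrix L. *)
Definition kron_op (R : realType) (S S' : Type) (p p' r s q q' : nat)
    (A : 'M[R]_(p, p')) (L : 'M[op R S S']_(r, s)) (B : 'M[R]_(q, q')) :
    'M[op R S S']_(p * (r * q), p' * (s * q')) :=
  \matrix_(a, b)
    let: (a1, a') := mxtens_unindex a in let: (a2, a3) := mxtens_unindex a' in
    let: (b1, b') := mxtens_unindex b in let: (b2, b3) := mxtens_unindex b' in
    fun f x => A a1 b1 * L a2 b2 f x * B a3 b3.

Lemma kron_at_rows (n i : nat) (nu : 'I_i) :
  (n ^ nu * (n * n ^ (i - nu.+1)) = n ^ i)%N.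
Proof. by rewrite -expnS -expnD addnS -addSn subnKC. Qed.

Lemma kron_at_cols (n j i : nat) (nu : 'I_i) :
  (n ^ nu * (n ^ j * n ^ (i - nu.+1)) = n ^ (j + i).-1)%N.
Proof.
rewrite -!expnD addnCA -subn1 -addnBA; last exact: leq_ltn_trans (ltn_ord nu).
congr (_ ^ (_ + _))%N.
by rewrite subn1 -[in RHS](subnKC (ltn_ord nu)).
Qed.

(* I_n (x) ... (x) L (x) ... (x) I_n, with i factors and L at position nu. *)
Definition kron_at (R : realType) (S S' : Type) (n j i : nat) (nu : 'I_i)
    (L : 'M[op R S S']_(n, n ^ j)) : 'M[op R S S']_(n ^ i, n ^ (j + i).-1) :=
  castmx (kron_at_rows n nu, kron_at_cols n j nu)
    (kron_op (kron (fun _ : 'I_nu => 1%:M : 'M[R]_n)) L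
             (kron (fun _ : 'I_(i - nu.+1) => 1%:M : 'M[R]_n))).

Section System.
Variables (R : realType) (n m : nat).

Let pt : Type := 'rV[R]_m.

Definition set_row (i : nat) (k : 'I_i) (x : pt) (X : 'M[R]_(i, m)) :
    'M[R]_(i, m) :=
  \matrix_j (if j == k then x else row j X).

(* Scalar operators acting in x_nu (and w), the other variables being fixed. *)
Definition act0 (i : nat) (nu : 'I_i) (f : pt -> R) :
    op R 'M[R]_(i, m) 'M[R]_(i, m) :=
  fun g X => f (row nu X) * g X.

Definition act1 (i : nat) (nu : 'I_i) (L : op R pt pt) :
    op R 'M[R]_(i, m) 'M[R]_(i, m) :=
  fun g X => L (fun x => g (set_row nu x X)) (row nu X).

Definition act2 (i : nat) (nu : 'I_i) (L : op R (pt * pt) pt) :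
    op R ('M[R]_(i, m) * pt) 'M[R]_(i, m) :=
  fun g X => L (fun xw => g (set_row nu xw.1 X, xw.2)) (row nu X).

(* x_j = x_(j+1) for all j >= nu; [lift nu] skips the value nu. *)
Definition shift_up (T : Type) (i : nat) (nu : 'I_i)
    (g : 'M[R]_(i.-1, m) -> T) : 'M[R]_(i, m) -> T :=
  fun X => g (rowsub (lift nu) X).

(* x_(nu+1) = w; here [lift ord0 nu] has value nu + 1. *)
Definition subst_w (T : Type) (i : nat) (nu : 'I_i)
    (g : 'M[R]_(i.+1, m) -> T) : 'M[R]_(i.+1, m) * pt -> T :=
  fun z => g (set_row (lift ord0 nu) z.2 z.1).

(* x_j = x_(j-1) for all j >= nu + 2.  It is applied to functions that do not
   depend on x_(nu+1), so the default value given to that slot is irrelevant. *)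
Definition shift_down (T : Type) (i : nat) (nu : 'I_i)
    (g : 'M[R]_(i.+1, m) * pt -> T) : 'M[R]_(i, m) * pt -> T :=
  fun z =>
    g (rowsub (fun j => odflt nu (unlift (lift ord0 nu) j)) z.1, z.2).

Variables (F0 : 'cV[pt -> R]_n) (F1 : 'M[op R pt pt]_n)
  (F2 : 'M[op R (pt * pt) pt]_(n, n ^ 2)).

Definition is_solution (u0 : pt -> 'cV[R]_n) (u : pt -> R -> 'cV[R]_n) : Prop :=
  (forall x, u x 0 = u0 x) /\
  forall x t, 0 <= t ->
    time_derivative (u x) t
      (map_mx (fun f => f x) F0
       + opmx_app F1 (fun x' => u x' t) x
       + opmx_app F2 (fun xw => u xw.1 t *t u xw.2 t) x).

Definition y (u : pt -> R -> 'cV[R]_n) (t : R) (i : nat) (X : 'M[R]_(i, m)) :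
    'cV[R]_(n ^ i) :=
  castmx (erefl, exp1n i) (kron (fun k => u (row k X) t)).

Definition A_prev (i : nat) (g : 'M[R]_(i.-1, m) -> 'cV[R]_(n ^ i.-1)) :
    'M[R]_(i, m) -> 'cV[R]_(n ^ i) :=
  fun X => \sum_(nu < i)
    opmx_app (@kron_at R _ _ n 0 i nu (map_mx (act0 nu) F0)) (shift_up nu g) X.

Definition A_diag (i : nat) (g : 'M[R]_(i, m) -> 'cV[R]_(n ^ i)) :
    'M[R]_(i, m) -> 'cV[R]_(n ^ i) :=
  fun X => \sum_(nu < i)
    opmx_app (@kron_at R _ _ n 1 i nu (map_mx (act1 nu) F1)) g X.

Definition A_next (i : nat) (g : 'M[R]_(i.+1, m) -> 'cV[R]_(n ^ i.+1)) :
    'M[R]_(i, m) -> 'cV[R]_(n ^ i) :=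
  fun X => \sum_(nu < i)
    opmx_app (@kron_at R _ _ n 2 i nu (map_mx (act2 nu) F2))
      (shift_down nu (subst_w nu g)) X.

End System.

(* Main.v *)
Require Import Defs.
From mathcomp Require Import all_boot all_order all_algebra.
From mathcomp Require Import all_classical all_reals all_analysis.
From mathcomp Require Import zify ring.
Import Order.TTheory GRing.Theory Num.Theory.
Import numFieldNormedType.Exports.
Local Open Scope classical_set_scope.
Local Open Scope ring_scope.

(** The components of y_i are indexed by the base-n digits d_1, ..., d_i of
    a < n ^ i, and the component of index a is the scalar product
    u_(d_1)(x_1) ... u_(d_i)(x_i).  By the product rule its time derivative is
    the sum over nu of the product in which the factor number nu is replaced by
    the right-hand side of the evolution equation at x_nu, i.e. by its F0, F1
    and F2 parts.  It remains to recognize each part, multiplied by the other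
    factors, as the summand nu of A_(i-1)^i, A_i^i and A_(i+1)^i.

    In row a, the operator matrix with L in position nu and identities elsewhere
    only has nonzero entries in the columns obtained from a by replacing its
    digit number nu by the j digits of a column b of L ([opmx_app_kron_at]).  In
    such a column the function acted upon, after the change of variables
    contained in the operator A, is the product of the same other factors with
    1, u_b(x_nu) or u_b1(x_nu) u_b2(w) according as j = 0, 1 or 2
    ([y_splice_prev], [y_splice_diag], [y_splice_next]).  The other factors do
    not depend on the variables in which L acts, so homogeneity of L lets them
    out ([pdo_onZ], [linear_onZ]), leaving the corresponding part of the
    evolution equation.  The derivative of the product is
    [slope_cvg_prod]. *)

(** * Base-n digits of indices of Kronecker powers *)

(** Serves to discard the digits that precede the one being read. *)
Lemma divn_exp_mod (p e f x : nat) :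
  (e < f)%N -> (x %% p ^ f %/ p ^ e %% p = x %/ p ^ e %% p)%N.
Proof.
move=> lt_ef; rewrite !modn_divl -expnS modn_dvdm //.
exact: dvdn_exp2l.
Qed.

Lemma digit_subproof {n i : nat} (a : 'I_(n ^ i)) (k : 'I_i) :
  (a %/ n ^ (i - k.+1) %% n < n)%N.
Proof.
rewrite ltn_mod lt0n; apply/eqP => n0; case: a => a /=.
by rewrite n0 exp0n // (leq_ltn_trans _ (ltn_ord k)).
Qed.

(** Digits are counted from the most significant one, as in the lexicographic
    order on multi-indices. *)
Definition digit {n i : nat} (a : 'I_(n ^ i)) (k : 'I_i) : 'I_n :=
  Ordinal (digit_subproof a k).

Lemma digitE {n i : nat} (a : 'I_(n ^ i)) (k : 'I_i) :
  val (digit a k) = (a %/ n ^ (i - k.+1) %% n)%N.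
Proof. by []. Qed.

Definition idx_before {n i : nat} (nu : 'I_i) (a : 'I_(n ^ i)) : 'I_(n ^ nu) :=
  (mxtens_unindex (cast_ord (esym (kron_at_rows n nu)) a)).1.

Definition idx_after {n i : nat} (nu : 'I_i) (a : 'I_(n ^ i)) :
    'I_(n ^ (i - nu.+1)) :=
  (mxtens_unindex
    (mxtens_unindex (cast_ord (esym (kron_at_rows n nu)) a)).2).2.

Definition join_idx {n j i : nat} {nu : 'I_i} (c1 : 'I_(n ^ nu))
    (b : 'I_(n ^ j)) (c3 : 'I_(n ^ (i - nu.+1))) : 'I_(n ^ (j + i).-1) :=
  cast_ord (kron_at_cols n j nu) (mxtens_index (c1, mxtens_index (b, c3))).

(** As a list of digits: a with its digit number nu replaced by the j digits of
    b, hence the length j + i - 1. *)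
Definition splice {n j i : nat} (nu : 'I_i) (a : 'I_(n ^ i)) (b : 'I_(n ^ j)) :
    'I_(n ^ (j + i).-1) :=
  join_idx (idx_before nu a) b (idx_after nu a).

(** The three lemmas [digit_splice_low], [digit_splice_mid] and
    [digit_splice_high] say that splicing acts on lists of digits as expected;
    positions are compared as natural numbers because they live in different
    ordinals. *)
Section DigitsOfSplice.
Variables (n j i : nat) (nu : 'I_i) (a : 'I_(n ^ i)) (b : 'I_(n ^ j)).
Let q := (n ^ (i - nu.+1))%N.

Lemma splice_ltn : (b * q + a %% q < n ^ j * q)%N.
Proof.
have := ltn_ord (mxtens_index (b, idx_after nu a)).
by rewrite /= modn_dvdm ?dvdn_mull.
Qed.

Lemma splice_val :
  splice nu a b = (a %/ (n * q) * (n ^ j * q) + (b * q + a %% q))%N :> nat.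
Proof. by rewrite /= modn_dvdm ?dvdn_mull. Qed.

Lemma splice_pow_gt0 : (0 < q)%N.
Proof. by have := splice_ltn; case: q => //; rewrite !muln0. Qed.

Lemma digit_splice_low (k : 'I_(j + i).-1) (k' : 'I_i) :
  k = k' :> nat -> (k < nu)%N -> digit (splice nu a b) k = digit a k'.
Proof.
move=> kk' k_nu; apply: val_inj; rewrite !digitE.
have i_nu := ltn_ord nu.
have -> : ((j + i).-1 - k.+1 = (j + (i - nu.+1)) + (nu - k.+1))%N by lia.
have -> : (i - k'.+1 = (1 + (i - nu.+1)) + (nu - k.+1))%N by lia.
have lt := splice_ltn.
rewrite splice_val !expnD expn1 -/q (divnMA _ (n ^ j * q)) (divnMA _ (n * q)).
by rewrite divnMDl ?(leq_ltn_trans _ lt) // (divn_small lt) addn0.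
Qed.

Lemma digit_splice_mid (k : 'I_(j + i).-1) (l : 'I_j) :
  k = (nu + l)%N :> nat -> digit (splice nu a b) k = digit b l.
Proof.
move=> kE; apply: val_inj; rewrite !digitE.
have i_nu := ltn_ord nu; have j_l := ltn_ord l.
have -> : ((j + i).-1 - k.+1 = (i - nu.+1) + (j - l.+1))%N by lia.
rewrite splice_val expnD divnMA -/q mulnA addnA -mulnDl.
rewrite divnMDl ?splice_pow_gt0 // (divn_small (ltn_pmod _ splice_pow_gt0)) addn0.
(* Modulo n ^ j only the digits of b are left. *)
rewrite -(divn_exp_mod _ _ j); last by lia.
by rewrite modnMDl (modn_small (ltn_ord b)).
Qed.

Lemma digit_splice_high (k : 'I_(j + i).-1) (k' : 'I_i) :
  k.+1 = (j + k')%N :> nat -> (nu < k')%N -> digit (splice nu a b) k = digit a k'.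
Proof.
move=> kk' nu_k; apply: val_inj; rewrite !digitE.
have i_nu := ltn_ord nu; have i_k' := ltn_ord k'.
have -> : ((j + i).-1 - k.+1 = i - k'.+1)%N by lia.
rewrite -(divn_exp_mod _ _ (i - nu.+1)); last by lia.
rewrite -[in RHS](divn_exp_mod _ _ (i - nu.+1)); last by lia.
by rewrite splice_val -/q mulnA addnA -mulnDl modnMDl modn_mod.
Qed.

End DigitsOfSplice.

Lemma digit0 {n i : nat} (a : 'I_(n ^ i.+1)) :
  (mxtens_unindex (cast_ord (expnS n i) a)).1 = digit a ord0.
Proof.
apply: val_inj; rewrite digitE subn1 /= modn_small //.
exact: (ltn_ord (mxtens_unindex (cast_ord (expnS n i) a)).1).
Qed.

Lemma digitS {n i : nat} (a : 'I_(n ^ i.+1)) (k : 'I_i) :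
  digit (mxtens_unindex (cast_ord (expnS n i) a)).2 k = digit a (lift ord0 k).
Proof.
apply: val_inj; rewrite !digitE subSS /= divn_exp_mod //.
by have := ltn_ord k; lia.
Qed.

(** * Kronecker products entrywise *)

Lemma kronE {R : realType} {p r i : nat} (A : 'I_i -> 'M[R]_(p, r)) a b :
  kron A a b = \prod_k A k (digit a k) (digit b k).
Proof.
elim: i => [|i IHi] in A a b *; first by rewrite big_ord0 mxE !ord1.
rewrite /= castmxE mxE IHi big_ord_recl !esymK !digit0.
by congr (_ * _); apply: eq_bigr => k _; rewrite !digitS.
Qed.

Lemma kron1 {R : realType} (n i : nat) :
  kron (fun _ : 'I_i => 1%:M : 'M[R]_n) = 1%:M.
Proof.
elim: i => // i IHi; rewrite /= IHi; apply/matrixP => a b.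
rewrite castmxE !mxE.
set a' := cast_ord _ a; set b' := cast_ord _ b.
have -> : (a == b) = (a' == b') by rewrite (inj_eq (@cast_ord_inj _ _ _)).
rewrite -natrM mulnb; congr ((nat_of_bool _)%:R).
by rewrite -(can_eq (@mxtens_unindexK _ _) a') -xpair_eqE.
Qed.

(** The identity factors contribute Kronecker deltas, because a Kronecker power
    of the identity is the identity. *)
Lemma kron_atE {R : realType} {S S' : Type} {n j i : nat} (nu : 'I_i)
    (L : 'M[op R S S']_(n, n ^ j)) a c1 b c3 :
  kron_at nu L a (join_idx c1 b c3) =
  fun f s => (idx_before nu a == c1)%:R * L (digit a nu) b f s
             * (idx_after nu a == c3)%:R.
Proof.
rewrite castmxE /join_idx cast_ordK mxE !mxtens_indexK !kron1.
have -> : digit a nu =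
    (mxtens_unindex (mxtens_unindex (cast_ord (esym (kron_at_rows n nu)) a)).2).1.
  by apply: val_inj; rewrite /= -modn_divl.
by apply/funext => f; apply/funext => s; rewrite !mxE.
Qed.

(** The columns that survive are exactly the splices of the row index, so the
    matrix product collapses to a sum over the columns of L. *)
Lemma opmx_app_kron_at {R : realType} {S S' : Type} {n j i : nat} (nu : 'I_i)
    (L : 'M[op R S S']_(n, n ^ j)) (g : S -> 'cV[R]_(n ^ (j + i).-1)) s a :
  opmx_app (kron_at nu L) g s a 0 =
  \sum_b L (digit a nu) b (fun s0 => g s0 (splice nu a b) 0) s.
Proof.
rewrite mxE (reindex (fun c : 'I_(n ^ nu) * ('I_(n ^ j) * 'I_(n ^ (i - nu.+1))) =>
  join_idx c.1 c.2.1 c.2.2)); last first.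
  exists (fun c => let c' := mxtens_unindex (cast_ord (esym (kron_at_cols n j nu)) c) in
     (c'.1, mxtens_unindex c'.2)) => [[c1 [c2 c3]]|c] _.
    by rewrite /join_idx cast_ordK !mxtens_indexK.
  by rewrite /join_idx !mxtens_unindexK cast_ordKV.
(* The columns agreeing with a outside position nu are split off. *)
rewrite (bigID (fun c => (idx_before nu a == c.1) && (idx_after nu a == c.2.2))) /=.
rewrite addrC big1 ?add0r => [|c]; last first.
  by rewrite negb_and kron_atE => /orP[] /negbTE ->; rewrite ?(mul0r, mulr0).
rewrite (reindex_onto (fun b => (idx_before nu a, (b, idx_after nu a)))
  (fun c => c.2.1)) /= => [|[c1 [c2 c3]] /= /andP[/eqP-> /eqP->] //].
apply: eq_big => [b|b _]; first by rewrite !eqxx.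
by rewrite kron_atE !eqxx mul1r mulr1.
Qed.

(** * The product rule along a filter *)

(** The time derivative is a limit along a filter that is one-sided at t = 0 and
    two-sided elsewhere; an arbitrary filter finer than the neighbourhoods of t
    covers both cases at once. *)
Section ProductRule.
Variables (R : realType) (t : R) (F : set_system R).
Hypotheses (FF : Filter F) (Ft : F --> t).

Definition slope_cvg (f : R -> R) (l : R) : Prop :=
  (fun s => (s - t)^-1 * (f s - f t)) @ F --> l.

Lemma cvg_ext (f g : R -> R) (l : R) : f =1 g -> f @ F --> l -> g @ F --> l.
Proof. by move=> /funext ->. Qed.

Lemma slope_cvg_continuous (f : R -> R) (l : R) :
  slope_cvg f l -> f @ F --> f t.
Proof.
move=> df.
have st : (fun s => s - t) @ F --> (0 : R).
  by rewrite -[X in _ --> X](subrr t); apply: cvgB; [exact: Ft | exact: cvg_cst].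
apply: (cvg_ext (fun s => (s - t) * ((s - t)^-1 * (f s - f t)) + f t)) => [s|].
  (* The identity also holds at s = t, where the inverse is 0. *)
  have [->|neq] := eqVneq s t; first by rewrite subrr mul0r add0r.
  by rewrite mulrA divff ?subr_eq0 // mul1r subrK.
rewrite -[X in _ --> X]add0r -(mul0r l).
by apply: cvgD; [exact: cvgM | exact: cvg_cst].
Qed.

Lemma slope_cvgM (f g : R -> R) (l k : R) :
  slope_cvg f l -> slope_cvg g k ->
  slope_cvg (fun s => f s * g s) (l * g t + f t * k).
Proof.
move=> df dg.
apply: (cvg_ext (fun s => (s - t)^-1 * (f s - f t) * g s
                          + f t * ((s - t)^-1 * (g s - g t)))) => [s|].
  by ring.
apply: cvgD; apply: cvgM => //; last exact: cvg_cst.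
exact: slope_cvg_continuous dg.
Qed.

(** Each summand keeps the whole product and changes one factor, so that it can
    be compared with a Kronecker product having one distinguished position. *)
Lemma slope_cvg_prod (i : nat) (f : 'I_i -> R -> R) (l : 'I_i -> R) :
  (forall k, slope_cvg (f k) (l k)) ->
  slope_cvg (fun s => \prod_k f k s)
    (\sum_nu \prod_k (if k == nu then l k else f k t)).
Proof.
elim: i => [|i IHi] in f l *.
  move=> _; rewrite big_ord0; apply: (cvg_ext (fun=> 0)); last exact: cvg_cst.
  by move=> s; rewrite !big_ord0 subrr mulr0.
move=> df.
have <- : l ord0 * \prod_k f (lift ord0 k) t + f ord0 t *
      \sum_nu \prod_k (if k == nu then l (lift ord0 k) else f (lift ord0 k) t) =
    \sum_nu \prod_k (if k == nu then l k else f k t).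
  rewrite big_ord_recl big_ord_recl eqxx mulr_sumr; congr (_ * _ + _).
  by apply: eq_bigr => nu _; rewrite [in RHS]big_ord_recl.
have := slope_cvgM _ _ _ _ (df ord0) (IHi _ _ (fun k => df (lift ord0 k))).
by apply: cvg_ext => s; rewrite !big_ord_recl.
Qed.

End ProductRule.

(** * Homogeneity of the operators *)

Lemma pderiveZ {R : realType} {m : nat} (c : R) (f : 'rV[R]_m -> R) s :
  pderivable s f -> pderive s (fun x => c * f x) = (fun x => c * pderive s f x).
Proof.
elim: s => //= k s IHs [/IHs-> df]; apply/funext => x.
exact: (deriveZ c (df x)).
Qed.

Lemma pdo_onZ {R : realType} {m : nat} (V : set ('rV[R]_m -> R)) L c f x :
  linear_space V -> pdo_on V L -> V f -> L (fun s => c * f s) x = c * L f x.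
Proof.
move=> [V0 VD] [r [a [d Ld]]] Vf.
have Vcf : V (fun s => c * f s).
  by have := VD c f _ Vf V0; congr V; apply/funext => s; rewrite addr0.
rewrite (Ld _ Vcf).2 (Ld _ Vf).2 mulr_sumr; apply: eq_bigr => k _.
by rewrite (pderiveZ _ _ _ ((Ld _ Vf).1 k)) mulrCA.
Qed.

(** Linearity on V is only available for combinations c f + g, so the case g = 0
    needs L 0 = 0, which follows from 0 = 1 * 0 + 0. *)
Lemma linear_onZ {R : realType} {S S' : Type} (V : set (S -> R))
    (L : op R S S') c f x :
  linear_space V -> linear_on V L -> V f -> L (fun s => c * f s) x = c * L f x.
Proof.
move=> [V0 _] linL Vf.
have L0 : L (fun=> 0) x = 0.
  have := linL 1 _ _ V0 V0 x; under eq_fun do rewrite mul1r addr0.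
  by rewrite mul1r => /eqP; rewrite -subr_eq0 opprD addNKr oppr_eq0 => /eqP.
have := linL c _ _ Vf V0 x; under eq_fun do rewrite addr0.
by rewrite L0 addr0.
Qed.

(** * Components of y after the changes of variables *)

Lemma prod_neq_lift {R : comPzRingType} {i : nat} (nu : 'I_i) (F : 'I_i -> R) :
  \prod_(k | k != nu) F k = \prod_(k < i.-1) F (lift nu k).
Proof.
rewrite big_mkcond; etransitivity; first exact: (@bigD1_ord _ _ _ _ nu xpredT).
rewrite /= eqxx mul1r; apply: eq_bigr => k _.
by rewrite eq_sym neq_lift.
Qed.

Section KroneckerPower.
Context {R : realType} {n m : nat} (u : 'rV[R]_m -> R -> 'cV[R]_n) (t : R).

Lemma yE {i : nat} (X : 'M[R]_(i, m)) c :
  y u t X c 0 = \prod_k u (row k X) t (digit c k) 0.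
Proof.
rewrite castmxE kronE cast_ord_id; apply: eq_bigr => k _.
by congr (u _ _ _ _); apply: ord1.
Qed.

Definition other_factors {i : nat} (nu : 'I_i) (a : 'I_(n ^ i))
    (X : 'M[R]_(i, m)) : R :=
  \prod_(k | k != nu) u (row k X) t (digit a k) 0.

Lemma row_set_row {i : nat} (nu k : 'I_i) x (X : 'M[R]_(i, m)) :
  row k (set_row nu x X) = if k == nu then x else row k X.
Proof. by apply/rowP => l; rewrite !mxE; case: ifP => // _; rewrite !mxE. Qed.

(** With j = 0 the digit number nu of a is deleted, and the shift of variables
    deletes x_nu at the same time, so the factor number nu is all that is lost. *)
Lemma y_splice_prev {i : nat} (nu : 'I_i) (a : 'I_(n ^ i)) (b : 'I_(n ^ 0))
    (X : 'M[R]_(i, m)) :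
  shift_up nu (@y R n m u t i.-1) X (splice nu a b) 0 = other_factors nu a X.
Proof.
rewrite yE /other_factors prod_neq_lift; apply: eq_bigr => k _.
rewrite row_rowsub; congr (u _ _ _ _); case: (ltnP k nu) => [lt_k|le_k].
  by apply: digit_splice_low => //; rewrite /= /bump leqNgt lt_k.
by apply: digit_splice_high; rewrite /= /bump le_k.
Qed.

Lemma y_splice_diag {i : nat} (nu : 'I_i) (a : 'I_(n ^ i)) (b : 'I_(n ^ 1)) x
    (X : 'M[R]_(i, m)) :
  y u t (set_row nu x X) (@splice n 1 i nu a b) 0 = other_factors nu a X * u x t b 0.
Proof.
rewrite yE (bigD1 nu) //= mulrC row_set_row eqxx; congr (_ * u _ _ _ _).
  apply: eq_bigr => k neq; rewrite row_set_row (negbTE neq).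
  congr (u _ _ _ _); have : k != nu :> nat by [].
  rewrite neq_ltn => /orP[lt_k|lt_k].
    exact: (@digit_splice_low n 1).
  exact: (@digit_splice_high n 1).
rewrite (@digit_splice_mid n 1 i nu a b nu ord0) ?addn0 //.
by apply: val_inj; rewrite digitE divn1 modn_small.
Qed.

(** Deleting position nu + 1 leaves the i variables of X with x_nu := x, while
    that position itself carries w; the two digits of b sit at nu and nu + 1. *)
Lemma y_splice_next {i : nat} (nu : 'I_i) (a : 'I_(n ^ i)) (b : 'I_(n ^ 2)) x w
    (X : 'M[R]_(i, m)) :
  shift_down nu (subst_w nu (@y R n m u t i.+1)) (set_row nu x X, w)
    (@splice n 2 i nu a b) 0
  = other_factors nu a X * (u x t *t u w t) b 0.
Proof.
rewrite yE (bigD1_ord (lift ord0 nu)) //= (bigD1 nu) //= mulrA mulrC.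
rewrite !row_set_row eqxx eq_sym (negbTE (neq_lift _ _)) row_rowsub liftK.
rewrite row_set_row eqxx mxE !ord1; congr (_ * _).
  apply: eq_bigr => k neq.
  rewrite row_set_row eq_sym (negbTE (neq_lift _ _)) row_rowsub liftK.
  rewrite row_set_row (negbTE neq).
  congr (u _ _ _ _); have : k != nu :> nat by [].
  rewrite neq_ltn => /orP[lt_k|lt_k].
    have kE : lift (lift ord0 nu) k = k :> nat by rewrite /= /bump /=; lia.
    by apply: (@digit_splice_low n 2) => //; rewrite kE.
  by apply: (@digit_splice_high n 2) => //; rewrite /= /bump /=; lia.
rewrite mulrC; congr (u _ _ _ _ * u _ _ _ _).
  rewrite (@digit_splice_mid n 2 i nu a b _ ord0).
    by apply: val_inj; rewrite digitE /= modn_small //; exact: mxtens_index_proof1.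
  by rewrite /= /bump /=; lia.
rewrite (@digit_splice_mid n 2 i nu a b _ ord_max).
  by apply: val_inj; rewrite digitE /= divn1.
by rewrite /= /bump /=; lia.
Qed.

End KroneckerPower.

(** * The tridiagonal system *)

Theorem proposition3p1 (R : realType) (n m : nat) (hn : (0 < n)%N) (hm : (0 < m)%N)
  (F0 : 'cV['rV[R]_m -> R]_n)
  (F1 : 'M[op R 'rV[R]_m 'rV[R]_m]_n)
  (F2 : 'M[op R ('rV[R]_m * 'rV[R]_m) 'rV[R]_m]_(n, n ^ 2))
  (V1 : set ('rV[R]_m -> R))
  (V2 : set ('rV[R]_m * 'rV[R]_m -> R))
  (hV1 : linear_space V1)
  (hV2 : linear_space V2)
  (hF1 : forall a b, pdo_on V1 (F1 a b))
  (hF2 : forall a b, linear_on V2 (F2 a b))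
  (u0 : 'rV[R]_m -> 'cV[R]_n)
  (u : 'rV[R]_m -> R -> 'cV[R]_n)
  (huV1 : forall t : R, 0 <= t -> forall b, V1 (fun x => u x t b 0))
  (huV2 : forall t : R, 0 <= t -> forall b c,
    V2 (fun xw => u xw.1 t b 0 * u xw.2 t c 0))
  (hu : is_solution F0 F1 F2 u0 u) :
  forall (i : nat), (0 < i)%N -> forall (t : R), 0 <= t ->
  forall X : 'M[R]_(i, m),
    time_derivative (fun s => y u s X) t
      (A_prev F0 (@y R n m u t i.-1) X
       + A_diag F1 (@y R n m u t i) X
       + A_next F2 (@y R n m u t i.+1) X).
Proof.
move=> i _ t t0 X a.
pose rhs x := map_mx (fun f => f x) F0 + opmx_app F1 (fun x' => u x' t) x
  + opmx_app F2 (fun xw => u xw.1 t *t u xw.2 t) x.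
have -> : (A_prev F0 (@y R n m u t i.-1) X + A_diag F1 (@y R n m u t i) X
       + A_next F2 (@y R n m u t i.+1) X) a 0 =
    \sum_nu \prod_k (if k == nu then rhs (row k X) (digit a k) 0
                     else u (row k X) t (digit a k) 0).
  have rhsE x b : rhs x b 0 = F0 b 0 x + \sum_c F1 b c (fun x' => u x' t c 0) x
      + \sum_c F2 b c (fun xw => (u xw.1 t *t u xw.2 t) c 0) x.
    by rewrite /rhs !mxE.
  rewrite mxE [X in X + _ = _]mxE !summxE -!big_split; apply: eq_bigr => nu _ /=.
  rewrite (bigD1 nu) //= eqxx mulrC.
  under eq_bigr => k /negbTE-> do [].
  rewrite -/(other_factors u t nu a X) rhsE !mulrDr.
  congr (_ + _ + _).
  - rewrite (opmx_app_kron_at (j := 0)) big_ord1 mxE /act0 y_splice_prev mulrC.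
    by congr (F0 _ _ _ * _); apply: ord1.
  - rewrite (opmx_app_kron_at (j := 1)) mulr_sumr; apply: eq_bigr => b _.
    rewrite mxE /act1.
    under eq_fun do rewrite y_splice_diag.
    by rewrite (pdo_onZ V1) //; exact: huV1.
  - rewrite (opmx_app_kron_at (j := 2)) mulr_sumr; apply: eq_bigr => b _.
    rewrite mxE /act2.
    under eq_fun do rewrite y_splice_next.
    rewrite (linear_onZ V2) //.
    by under eq_fun do rewrite mxE !ord1; exact: huV2.
under eq_fun do rewrite !yE.
apply: slope_cvg_prod => [|k].
  exact: cvg_trans (cvg_within _) (@nbhs_dnbhs _ t).
exact: (hu.2 (row k X) t t0 (digit a k)).
Qed.
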